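(* Let $n\ge2$ and let $Q$ be a finite sequence of elements of $\{1,\dots,n-1\}$. For $1\le r<n$ and $m\ge1$, one has $t_r(Q)\le m$ if and only if $$\sum_{\alpha=1}^{m}d_Q(c_{\alpha-1},c_\alpha)\ge r$$ for every choice of $c_1,\dots,c_{m-1}\in\{0,\dots,n\}$, where $c_0=n-r$ and $c_m=r$. In particular, all the numbers $t_r(Q)$, $1\le r<n$, depend on $Q$ only through the permutation matrix $P_Q$ of $\sigma_Q$ (equivalently, only through $\sigma_Q$).
   Context: For $a\in\{1,\dots,n-1\}$ and $I\subseteq[n]=\{1,\dots,n\}$, let $c_a^+(I)=(I\setminus\{a\})\cup\{a+1\}$ if $a\in I$ and $a+1\notin I$, and $c_a^+(I)=I$ otherwise. For $Q=(q_1,\dots,q_\ell)$, a $Q$-pass applies $c_{q_1}^+,\dots,c_{q_\ell}^+$ successively, in that order ($c_{q_1}^+$ first). With $L_k=\{1,\dots,k\}$ and $R_k=\{n-k+1,\dots,n\}$, $t_k(Q)$ is the least number $m\ge1$ of repeated $Q$-passes carrying $L_k$ to $R_k$, with $t_k(Q)=\infty$ if this never occurs. The permutation $\sigma_Q=(\sigma_1,\dots,\sigma_n)$ (one-line notation) is obtained as follows: begin with the list $(1,2,\dots,n)$; for $r=1,\dots,\ell$ in order, at step $r$ interchange the entries in positions $q_r$ and $q_r+1$ of the current list if the left entry is smaller than the right one, and otherwise do nothing; the final list is $\sigma_Q$. Its southwest rectangle counts are $d_Q(p,q)=\#\{i>p:\sigma_i\le q\}$ for $0\le p,q\le n$; equivalently,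 $d_Q(p,q)$ is the rank of the submatrix $P_Q[\{p+1,\dots,n\},\{1,\dots,q\}]$ of the permutation matrix $P_Q$ having its ones in positions $(i,\sigma_i)$. *)

(* Defs.v *)
From mathcomp Require Import all_boot all_algebra all_fingroup.
From mathcomp Require Import boolp.
Set Implicit Arguments.
Unset Strict Implicit.
Unset Printing Implicit Defensive.

(* Indexing is shifted by one: i : 'I_n stands for the element
   i + 1 of [n], and a : 'I_n.-1 for the letter a + 1 of {1, ..., n - 1}.
   Cardinalities, bounds, numbers of passes and the arguments p, q of
   [sw_count] are not shifted. *)

Definition lpos n (a : 'I_n.-1) : 'I_n := widen_ord (leq_pred n) a.

Lemma rpos_subproof n (a : 'I_n.-1) : a.+1 < n.
Proof. by rewrite -ltn_predRL. Qed.

Definition rpos n (a : 'I_n.-1) : 'I_n := Ordinal (rpos_subproof a).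

Definition c_plus n (a : 'I_n.-1) (I : {set 'I_n}) : {set 'I_n} :=
  if (lpos a \in I) && (rpos a \notin I) then rpos a |: (I :\ lpos a) else I.

Definition pass n (Q : seq 'I_n.-1) (I : {set 'I_n}) : {set 'I_n} :=
  foldl (fun J a => c_plus a J) I Q.

Definition Lset n k : {set 'I_n} := [set i : 'I_n | i < k].
Definition Rset n k : {set 'I_n} := [set i : 'I_n | n - k <= i].

Definition carries n (Q : seq 'I_n.-1) k : pred nat :=
  fun m => (0 < m) && (iter m (pass Q) (Lset n k) == Rset n k).

(* [None] is the value infinity. *)
Definition passage_time n (Q : seq 'I_n.-1) k : option nat :=
  match pselect (exists m, carries Q k m) with
  | left ex => Some (ex_minn ex)
  | right _ => None
  end.

Definition time_le (t : option nat) (m : nat) : bool :=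
  if t is Some k then k <= m else false.

(* One-line notation: s i is the entry in position i. Since
   (tperm x y * s) i = s (tperm x y i), multiplying by tperm on the left
   interchanges the entries in positions x and y. *)
Definition sort_step n (s : 'S_n) (a : 'I_n.-1) : 'S_n :=
  if s (lpos a) < s (rpos a) then (tperm (lpos a) (rpos a) * s)%g else s.

Definition sigma n (Q : seq 'I_n.-1) : 'S_n := foldl (@sort_step n) 1%g Q.

Definition perm_matrix n (Q : seq 'I_n.-1) : 'M[rat]_n := perm_mx (sigma Q).

(* In unshifted terms the conditions read i > p and sigma_i <= q. *)
Definition sw_count n (Q : seq 'I_n.-1) (p q : nat) : nat :=
  #|[set i : 'I_n | (p <= i) && (sigma Q i < q)]|.

(* Main.v *)
Require Import Defs.
From mathcomp Require Import all_boot all_algebra all_fingroup.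
From mathcomp Require Import boolp zify.
Set Implicit Arguments.
Unset Strict Implicit.
Unset Printing Implicit Defensive.

(** A set [I] is encoded by its tail counts, [tail_count I p] being the number
    of elements of [I] at or to the right of position [p].  In this encoding an
    operator [c_plus a] changes a single value, and does so by a linear formula
    of min-plus algebra: the new count at [a.+1] is the minimum of the old
    count at [a] and of one plus the old count at [a.+2] ([leq_tail_c_plus]).
    A composite of such operators is therefore min-plus linear as well, and a
    linear map is known from its values on generators.  The initial segments
    [Lset n q] generate, and their images are read off [sigma Q]: the positions
    of the entries below [q] evolve under sorting exactly as [Lset n q] does
    under the [c_plus a] ([sigma_lt_pass]).  Hence [sw_count Q] is the min-plus
    matrix of a [Q]-pass:
      [tail_count (pass Q I) p
         = min_(q <= n) (sw_count Q p q + tail_count I q)]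
    ([leq_tail_pass]).

    The count after [m] passes started at [Lset n r] is then an entry of the
    [m]-th min-plus power of that matrix, that is, a minimum over the paths
    [c] of the statement ([leq_tail_iter_pass]).  Since a pass preserves
    cardinality, the image of [Lset n r] is [Rset n r] as soon as its count at
    [n - r] reaches [r]; and as [Rset n r] is a fixed point, arriving within
    [m] passes is the same as being there after exactly [m].  Finally a set is
    determined by its tail counts, so that a pass depends only on [sw_count Q],
    hence only on [sigma Q].

    Minima are expressed throughout by their lower bounds: [k <= min_q F q] is
    written as the condition that [k <= F q] for all [q]. *)

(** * Tail counts *)

Definition tail_count n (I : {set 'I_n}) (p : nat) : nat :=
  #|[set i in I | p <= i]|.

Lemma tail_countS n (I : {set 'I_n}) (i : 'I_n) :
  tail_count I i = (i \in I) + tail_count I i.+1.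
Proof.
rewrite /tail_count (cardsD1 i) inE leqnn andbT; congr (_ + _).
by apply: eq_card => j; rewrite !inE ltn_neqAle (eq_sym j) andbCA.
Qed.

Lemma tail_count_inj n (I J : {set 'I_n}) :
  (forall p, p <= n -> tail_count I p = tail_count J p) -> I = J.
Proof.
move=> eqIJ; apply/setP => i.
have := eqIJ i (ltnW (ltn_ord i)); rewrite !tail_countS eqIJ //.
by move/addIn; case: (i \in I); case: (i \in J).
Qed.

Lemma tail_count0 n (I : {set 'I_n}) : tail_count I 0 = #|I|.
Proof. by apply: eq_card => i; rewrite !inE andbT. Qed.

(** An element of [I] at or beyond [p] is either below [q], hence in the initial
    segment, or at or beyond [q]. *)
Lemma tail_count_leq_Lset n (I : {set 'I_n}) p q :
  tail_count I p <= tail_count (Lset n q) p + tail_count I q.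
Proof.
apply: leq_trans (leq_card_setU _ _); apply: subset_leq_card.
apply/subsetP => i; rewrite !inE => /andP[-> ->].
by case: leqP; rewrite ?orbT ?andbT.
Qed.

Lemma tail_count_Lset n q : tail_count (Lset n q) q = 0.
Proof. by apply: eq_card0 => i; rewrite !inE ltnNge andNb. Qed.

(** * The min-plus action of a pass *)

Lemma in_c_plus n (a : 'I_n.-1) (I : {set 'I_n}) i :
  (i \in c_plus a I) =
  if i == lpos a then (lpos a \in I) && (rpos a \in I)
  else if i == rpos a then (lpos a \in I) || (rpos a \in I)
  else i \in I.
Proof.
have neq : (rpos a == lpos a) = false by rewrite -val_eqE /= gtn_eqF.
rewrite /c_plus; have [-> | nl] := eqVneq i (lpos a).
  case: ifP; rewrite ?inE ?eqxx ?(eq_sym (lpos a)) ?neq.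
    by case/andP=> _ /negPf->; rewrite andbF.
  by case: (lpos a \in I); case: (rpos a \in I).
have [-> | nr] := eqVneq i (rpos a).
  case: ifP; first by rewrite !inE eqxx => /andP[->].
  by case: (lpos a \in I); case: (rpos a \in I).
by case: ifP; rewrite ?inE ?(negPf nl) ?(negPf nr).
Qed.

(** The elements [a] and [a.+1] lie on the same side of every cut other than
    the one between them. *)
Lemma tail_c_plus_neq n (a : 'I_n.-1) (I : {set 'I_n}) p :
  p != a.+1 -> tail_count (c_plus a I) p = tail_count I p.
Proof.
have above q : a.+1 < q -> tail_count (c_plus a I) q = tail_count I q.
  move=> lt_aq; apply: eq_card => i; rewrite !inE in_c_plus.
  case: eqP => [->|_] /=; first by rewrite leqNgt ltnW ?andbF.
  by case: eqP => [->|_] //=; rewrite leqNgt lt_aq !andbF.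
(* The count at [a] sees both elements, and [c_plus a] permutes their
   membership bits. *)
have ata : tail_count (c_plus a I) a = tail_count I a.
  have splitE J : tail_count J a = (lpos a \in J) + ((rpos a \in J) +
      tail_count J a.+2).
    by rewrite (tail_countS J (lpos a)) (tail_countS J (rpos a)).
  rewrite !splitE above // !in_c_plus eqxx -val_eqE /= gtn_eqF // eqxx.
  by case: (lpos a \in I); case: (rpos a \in I).
move=> neq_pa; have [le_pa | ] := leqP p a; last first.
  by rewrite leq_eqVlt eq_sym (negPf neq_pa) => /above.
have [d def_a] : exists d, d + p = a by exists (a - p); apply: subnK.
elim: d p {neq_pa le_pa} def_a => [|d IHd] p; first by rewrite add0n => ->.
move=> def_a; have lt_pa : p < a by rewrite -def_a addSn ltnS leq_addl.
have lt_pn : p < n by apply: leq_trans (ltn_ord (lpos a)); apply: ltnW.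
rewrite !(tail_countS _ (Ordinal lt_pn)) /= IHd ?addnS -?addSn //.
congr (nat_of_bool _ + _); rewrite in_c_plus -!val_eqE /=.
by rewrite !ltn_eqF // ltnW.
Qed.

(** The old count at [a.+1] respects both bounds, and attains one of them unless
    [a] is in [I] and [a.+1] is not, which is when the element moves; it is then
    one less than both. *)
Lemma leq_tail_c_plus n (a : 'I_n.-1) (I : {set 'I_n}) k :
  (k <= tail_count (c_plus a I) a.+1) =
  (k <= tail_count I a) && (k <= (tail_count I a.+2).+1).
Proof.
rewrite (tail_countS _ (rpos a)) tail_c_plus_neq ?gtn_eqF //.
rewrite in_c_plus -val_eqE /= gtn_eqF // eqxx.
rewrite (tail_countS I (lpos a)) (tail_countS I (rpos a)) /=.
by case: (lpos a \in I); case: (rpos a \in I) => /=; lia.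
Qed.

Lemma pass_rcons n (Q : seq 'I_n.-1) a I :
  pass (rcons Q a) I = c_plus a (pass Q I).
Proof. by rewrite /pass foldl_rcons. Qed.

Lemma card_pass n (Q : seq 'I_n.-1) I : #|pass Q I| = #|I|.
Proof.
elim/last_ind: Q => [|Q a IHQ] //.
by rewrite pass_rcons -tail_count0 tail_c_plus_neq // tail_count0.
Qed.

(** Each [c_plus a] is min-plus linear in the tail counts, so it suffices to
    decompose [I] over the initial segments, which is the case of empty [Q]:
    there the minimum is attained at [q = p]. *)
Lemma leq_tail_pass_Lset n (Q : seq 'I_n.-1) (I : {set 'I_n}) p k : p <= n ->
  k <= tail_count (pass Q I) p <->
  (forall q, q <= n ->
     k <= tail_count (pass Q (Lset n q)) p + tail_count I q).
Proof.
elim/last_ind: Q p k => [|Q a IHQ] p k le_pn.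
  split=> [le_k q _ | /(_ p le_pn)]; last by rewrite tail_count_Lset.
  exact: leq_trans le_k (tail_count_leq_Lset I p q).
rewrite pass_rcons; have [-> | neq_pa] := eqVneq p a.+1; last first.
  rewrite tail_c_plus_neq //; split=> [le_k q le_qn | le_k].
    by rewrite pass_rcons tail_c_plus_neq //; apply/IHQ: q le_qn.
  apply/IHQ => // q le_qn.
  by have := le_k q le_qn; rewrite pass_rcons tail_c_plus_neq.
have le_an : a <= n := ltnW (ltn_ord (lpos a)).
have le_a2n : a.+2 <= n := rpos_subproof a.
(* The bound [k <= x.+1] is used in the form [k.-1 <= x], to which the
   hypothesis at [a.+2] applies. *)
rewrite leq_tail_c_plus; split=> [/andP[le_k1 le_k2] q le_qn | le_k].
  rewrite pass_rcons addnC -leq_subLR leq_tail_c_plus.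
  have le_k3 : k.-1 <= tail_count (pass Q I) a.+2 by lia.
  have := (IHQ a k le_an).1 le_k1 q le_qn.
  have := (IHQ a.+2 k.-1 le_a2n).1 le_k3 q le_qn; lia.
have split_k q : q <= n ->
    k <= tail_count (pass Q (Lset n q)) a + tail_count I q /\
    k.-1 <= tail_count (pass Q (Lset n q)) a.+2 + tail_count I q.
  move=> le_qn; have := le_k q le_qn.
  by rewrite pass_rcons addnC -leq_subLR leq_tail_c_plus => /andP[]; lia.
apply/andP; split; first by apply/(IHQ a) => // q /split_k[].
suff: k.-1 <= tail_count (pass Q I) a.+2 by lia.
by apply/(IHQ a.+2) => // q /split_k[].
Qed.

(** * Reading a pass off the permutation *)

(** If exactly one of two adjacent entries is below [q], then sorting puts it
    on the right; otherwise the positions in question are not affected by an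
    interchange. *)
Lemma sort_step_lt n (s : 'S_n) (a : 'I_n.-1) q :
  [set i | sort_step s a i < q] = c_plus a [set i | s i < q].
Proof.
apply/setP => i; rewrite in_c_plus !inE /sort_step.
have neq : lpos a != rpos a by rewrite -val_eqE /= ltn_eqF.
case: (ltnP (s (lpos a)) (s (rpos a))) => lt_s.
  rewrite permM; case: tpermP => [->|->|/eqP/negPf-> /eqP/negPf->] //.
    by rewrite eqxx; lia.
  by rewrite eq_sym (negPf neq) eqxx; lia.
by case: eqP => [->|_]; last case: eqP => [->|_] //; lia.
Qed.

Lemma sigma_lt_pass n (Q : seq 'I_n.-1) q :
  [set i | sigma Q i < q] = pass Q (Lset n q).
Proof.
elim/last_ind: Q => [|Q a IHQ].
  by apply/setP => i; rewrite !inE perm1.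
by rewrite pass_rcons -IHQ -sort_step_lt /sigma foldl_rcons.
Qed.

Lemma sw_countE n (Q : seq 'I_n.-1) p q :
  sw_count Q p q = tail_count (pass Q (Lset n q)) p.
Proof.
by rewrite -sigma_lt_pass; apply: eq_card => i; rewrite !inE andbC.
Qed.

(** The counts [sw_count Q] form the min-plus matrix of a [Q]-pass. *)
Lemma leq_tail_pass n (Q : seq 'I_n.-1) (I : {set 'I_n}) p k : p <= n ->
  k <= tail_count (pass Q I) p <->
  (forall q, q <= n -> k <= sw_count Q p q + tail_count I q).
Proof.
move=> le_pn; rewrite leq_tail_pass_Lset //.
by split=> le_k q /le_k; rewrite sw_countE.
Qed.

(** Two tail counts with the same lower bounds are equal, and their lower
    bounds are given by [sw_count]. *)
Lemma eq_sigma_pass n (Q Q' : seq 'I_n.-1) :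
  sigma Q = sigma Q' -> pass Q = pass Q'.
Proof.
move=> eqQ; have eq_sw p q : sw_count Q p q = sw_count Q' p q.
  by rewrite /sw_count eqQ.
apply: funext => I; apply: tail_count_inj => p le_pn.
apply/eqP; rewrite eqn_leq; apply/andP; split; apply/leq_tail_pass => // q.
  by rewrite -eq_sw; move: q; apply/leq_tail_pass.
by rewrite eq_sw; move: q; apply/leq_tail_pass.
Qed.

Lemma eq_sigma_passage_time n (Q Q' : seq 'I_n.-1) r :
  sigma Q = sigma Q' -> passage_time Q r = passage_time Q' r.
Proof.
move/eq_sigma_pass=> eqQ; rewrite /passage_time.
by have -> : carries Q r = carries Q' r by rewrite /carries eqQ.
Qed.

Lemma perm_mx_inj (R : nzSemiRingType) n : injective (@perm_mx R n).
Proof.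
move=> s t /matrixP eq_st; apply/permP => i.
have := eq_st i (t i); rewrite !mxE eqxx.
by case: eqP => // _ /eqP; rewrite eq_sym GRing.oner_eq0.
Qed.

(** * Repeated passes *)

(** A power of a min-plus matrix is a minimum over paths; a path of length
    [m.+2] is a first step followed by a path of length [m.+1].  The last
    vertex is pinned to [r] because the counts of [pass Q (Lset n r)] are
    themselves a column of the matrix. *)
Lemma leq_tail_iter_pass n (Q : seq 'I_n.-1) r m p k : p <= n ->
  k <= tail_count (iter m.+1 (pass Q) (Lset n r)) p <->
  (forall c : nat -> nat,
     c 0 = p -> c m.+1 = r -> (forall a, 1 <= a < m.+1 -> c a <= n) ->
     k <= \sum_(1 <= a < m.+2) sw_count Q (c a.-1) (c a)).
Proof.
elim: m p k => [|m IHm] p k le_pn.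
  split=> [le_k c c0 c1 _ | le_k].
    by rewrite big_nat1 /= c0 c1 sw_countE.
  have := le_k (fun a => if a is 0 then p else r).
  by rewrite big_nat1 /= sw_countE; apply=> //; case.
rewrite iterS leq_tail_pass //.
split=> [le_k c c0 cm le_cn | le_k q le_qn].
  rewrite big_ltn // big_add1 /= c0 -leq_subLR.
  have le_c1n : c 1 <= n by apply: le_cn.
  have := le_k _ le_c1n; rewrite -leq_subLR => /IHm.
  move=> /(_ le_c1n (fun a => c a.+1)) /=.
  rewrite (eq_big_nat _ _ (F2 := fun a => sw_count Q (c a) (c a.+1))).
    by apply=> // a /andP[_ lt_am]; apply: le_cn.
  by case.
rewrite -leq_subLR; apply/IHm => // c c0 cm le_cn.
have := le_k (fun a => if a is b.+1 then c b else p).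
rewrite big_ltn // big_add1 /= c0 -leq_subLR.
rewrite (eq_big_nat _ _ (F2 := fun a => sw_count Q (c a.-1) (c a))).
  apply=> // -[|[|a]] //=; first by rewrite c0.
  by move=> lt_am; apply: le_cn.
by case.
Qed.

(** * Arrival at the final segment *)

Lemma card_Lset n k : k <= n -> #|Lset n k| = k.
Proof.
move=> le_kn; rewrite /Lset -sum1dep_card.
by rewrite (big_ord_narrow le_kn) sum1_card card_ord.
Qed.

Lemma card_Rset n k : k <= n -> #|Rset n k| = k.
Proof.
move=> le_kn; have -> : Rset n k = ~: Lset n (n - k).
  by apply/setP => i; rewrite !inE leqNgt.
by rewrite cardsCs setCK card_ord card_Lset ?leq_subr ?subKn.
Qed.

Lemma eq_Rset_tail n (J : {set 'I_n}) r : r <= n -> #|J| = r ->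
  (J == Rset n r) = (r <= tail_count J (n - r)).
Proof.
move=> le_rn cardJ.
have -> : tail_count J (n - r) = #|J :&: Rset n r|.
  by apply: eq_card => i; rewrite !inE.
apply/eqP/idP => [-> | le_r]; first by rewrite setIid card_Rset.
apply/eqP; rewrite eqEcard card_Rset // cardJ leqnn andbT.
by apply/setIidPl/eqP; rewrite eqEcard subsetIl cardJ.
Qed.

Lemma pass_Rset n (Q : seq 'I_n.-1) k : pass Q (Rset n k) = Rset n k.
Proof.
elim/last_ind: Q => [|Q a IHQ] //; rewrite pass_rcons IHQ /c_plus ifF // !inE.
by apply/negP => /andP[/= le_ka /negP[]]; apply: leqW.
Qed.

(** The final segment is fixed by a pass, so the sets stay there once they have
    arrived. *)
Lemma time_le_passageE n (Q : seq 'I_n.-1) r m : 0 < m ->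
  time_le (passage_time Q r) m = (iter m (pass Q) (Lset n r) == Rset n r).
Proof.
move=> m_gt0; rewrite /passage_time; case: pselect => [ex | nex] /=; last first.
  by apply/esym/negP => eq_m; apply: nex; exists m; rewrite /carries m_gt0.
case: ex_minnP => k /andP[_ /eqP eq_k] min_k.
apply/idP/idP => [le_km | eq_m]; last by apply: min_k; rewrite /carries m_gt0.
rewrite -(subnK le_km) iterD eq_k; apply/eqP.
by elim: (m - k) => //= d ->; apply: pass_Rset.
Qed.

Theorem theorem7p6 (n : nat) (hn : 2 <= n) :
  (forall (Q : seq 'I_n.-1) (r m : nat), 1 <= r < n -> 1 <= m ->
     time_le (passage_time Q r) m <->
     (forall c : nat -> nat,
        c 0 = n - r -> c m = r ->
        (forall a, 1 <= a < m -> c a <= n) ->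
        r <= \sum_(1 <= a < m.+1) sw_count Q (c a.-1) (c a)))
  /\ (forall Q Q' : seq 'I_n.-1, perm_matrix Q = perm_matrix Q' ->
        forall r : nat, 1 <= r < n -> passage_time Q r = passage_time Q' r)
  /\ (forall Q Q' : seq 'I_n.-1, sigma Q = sigma Q' ->
        forall r : nat, 1 <= r < n -> passage_time Q r = passage_time Q' r).
Proof.
split; last split.
- move=> Q r [|m] // /andP[_ /ltnW le_rn] _.
  rewrite time_le_passageE // eq_Rset_tail //.
    exact: leq_tail_iter_pass (leq_subr r n).
  by elim: m.+1 => [|d IHd]; rewrite ?iterS ?card_pass //= card_Lset.
- by move=> Q Q' /perm_mx_inj eqQ r _; apply: eq_sigma_passage_time.
- by move=> Q Q' eqQ r _; apply: eq_sigma_passage_time.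
Qed.
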